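(* Let $\sigma_1>\sigma_2>\cdots>\sigma_n>0$ be the singular values of the matrix $A\in\mathbb{R}^{m\times n}$ ($m\ge n$) of a severely ill-posed problem, i.e. $\sigma_j=\mathcal{O}(\rho^{-j})$, $j=1,2,\dots,n$, with suitable $\rho>1$. For $k=2,3,\ldots,n-1$ and $j=1,\dots,k$ put $$|L_j^{(k)}(0)|=\prod_{i=1,\,i\ne j}^k\frac{\sigma_i^2}{|\sigma_j^2-\sigma_i^2|},\qquad |L_{k_1}^{(k)}(0)|=\max_{j=1,2,\ldots,k}|L_j^{(k)}(0)|.$$ Then for $k=2,3,\ldots,n-1$ we have $$|L_k^{(k)}(0)|=1+\mathcal{O}(\rho^{-2}),$$ $$|L_j^{(k)}(0)|=\frac{1+\mathcal{O}(\rho^{-2})}{\prod_{i=j+1}^k\left(\frac{\sigma_{j}}{\sigma_i}\right)^2}=\frac{1+\mathcal{O}(\rho^{-2})}{\mathcal{O}(\rho^{(k-j)(k-j+1)})},\quad j=1,2,\ldots,k-1,$$ $$|L_{k_1}^{(k)}(0)|=1+\mathcal{O}(\rho^{-2}).$$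
   Context: Meaning of the order notation: $\sigma_j=\mathcal{O}(\rho^{-j})$, $j=1,\dots,n$, is understood in the two-sided sense that there are constants $c_2\ge c_1>0$ with $c_1\rho^{-j}\le\sigma_j\le c_2\rho^{-j}$ for all $j$. ''Suitable $\rho>1$'' means that $\rho\ge\rho_0$ for some $\rho_0>1$ depending only on $c_1,c_2$ (i.e. $\rho$ is not too close to $1$). A quantity equal to $1+\mathcal{O}(\rho^{-2})$ is one that differs from $1$ by at most $C\rho^{-2}$ in absolute value, with $C$ depending only on $c_1,c_2$ and $\rho_0$ (not on $n$, $k$, $j$). The denominator $\mathcal{O}(\rho^{(k-j)(k-j+1)})$ is the quantity $\prod_{i=j+1}^k(\sigma_j/\sigma_i)^2$, and $\mathcal{O}$ there means exact order, i.e. bounded above and below by positive multiples of $\rho^{(k-j)(k-j+1)}$, where the multiples depend only on $c_1,c_2$ and $k-j$. *)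

(* Defs.v *)
From HB Require Import structures.
From mathcomp Require Import all_boot all_order all_algebra reals.

Set Implicit Arguments.
Unset Strict Implicit.
Unset Printing Implicit Defensive.

Import Order.TTheory GRing.Theory Num.Theory.
Local Open Scope ring_scope.

(* Families of singular values are functions [nat -> R] indexed from 1, as in
   sigma_1, ..., sigma_n; values at 0 and beyond n are irrelevant.  Matrix
   indices start from 0, whence the [j.+1] below. *)

Definition orthogonal_mx (R : realType) (n : nat) (U : 'M[R]_n) : Prop :=
  U^T *m U = 1%:M /\ U *m U^T = 1%:M.

Definition sigma_mx (R : realType) (m n : nat) (sigma : nat -> R) :
    'M[R]_(m, n) :=
  \matrix_(i < m, j < n) (if (i : nat) == j then sigma j.+1 else 0).

(* Through the full singular value decomposition A = U Sigma V^T; meaningful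
   for n <= m. *)
Definition singular_values (R : realType) (m n : nat) (A : 'M[R]_(m, n))
    (sigma : nat -> R) : Prop :=
  [/\ forall j, (1 <= j <= n)%N -> 0 <= sigma j,
      forall i j, (1 <= i)%N -> (i <= j)%N -> (j <= n)%N -> sigma j <= sigma i
    & exists (U : 'M[R]_m) (V : 'M[R]_n),
        [/\ orthogonal_mx U, orthogonal_mx V
          & A = U *m sigma_mx m n sigma *m V^T]].

(* sigma_j = O(rho^{-j}), two-sided, with the constants made explicit. *)
Definition severely_ill_posed (R : realType) (c1 c2 rho : R) (n : nat)
    (sigma : nat -> R) : Prop :=
  forall j, (1 <= j <= n)%N -> c1 * rho ^- j <= sigma j <= c2 * rho ^- j.

(* |L_j^{(k)}(0)|, where L_j^{(k)} is the Lagrange basis polynomial for the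
   nodes sigma_1^2, ..., sigma_k^2. *)
Definition absL0 (R : realType) (sigma : nat -> R) (k j : nat) : R :=
  \prod_(1 <= i < k.+1 | i != j)
     (sigma i ^+ 2 / `|sigma j ^+ 2 - sigma i ^+ 2|).

(* x = 1 + O(rho^{-2}) with constant C. *)
Definition one_plus_O (R : realType) (C rho x : R) : Prop :=
  `|x - 1| <= C * rho ^- 2.

(* Main.v *)
Require Import Defs.
From HB Require Import structures.
From mathcomp Require Import all_boot all_order all_algebra reals.
From mathcomp Require Import zify ring lra.

Set Implicit Arguments.
Unset Strict Implicit.
Unset Printing Implicit Defensive.

Import Order.TTheory GRing.Theory Num.Theory.
Local Open Scope ring_scope.

(** Dividing numerator and denominator of each factor of |L_j^(k)(0)| by the
    larger of sigma_i^2 and sigma_j^2 gives 1 / (1 - r_i) when i < j, and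
    (sigma_i / sigma_j)^2 / (1 - r_i) when i > j, where r_i < 1 is the smaller
    square over the larger one.  Hence |L_j^(k)(0)| = x / D with
    D = prod_(i > j) (sigma_j / sigma_i)^2 and x = prod_(i != j) 1 / (1 - r_i)
    ([absL0_split]); for j = k the product D is empty.

    The correction x is close to 1 uniformly in n, k and j because the r_i are
    summable.  With K = (c2 / c1)^2 and t = K / rho^2, the two-sided decay of
    sigma gives r_i <= t^|i - j| ([small_ratio_bounds]), so for t <= 1/8 two
    geometric series bound the sum of the r_i by 4 t.  The Weierstrass
    inequality prod (1 - r_i) >= 1 - sum r_i then yields 1 <= x <= 1 + 8 t
    ([prod_inv_1sub_bounds]), that is x = 1 + O(rho^-2) with constant 8 K.

    The exact order of D comes from multiplying the two-sided bounds on
    (sigma_j / sigma_i)^2, the exponents 2 + 4 + ... + 2 (k - j) adding up to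
    (k - j) (k - j + 1) ([prod_sqrd_ratio_bounds]).  Finally, D >= 1 shows that
    no |L_j^(k)(0)| exceeds 1 + 8 t, while |L_k^(k)(0)| >= 1, so their maximum
    lies between 1 and 1 + 8 t. *)

(** * Products near 1 and geometric sums *)

(** The Weierstrass product inequality, by induction on the number of factors:
    the cross term in (1 - x) (1 - S) = 1 - x - S + x S is nonnegative. *)
Lemma prod_1sub_ge (R : realDomainType) (I : Type) (s : seq I) (P : pred I)
    (r : I -> R) (r01 : forall i, P i -> 0 <= r i <= 1) :
  1 - \sum_(i <- s | P i) r i <= \prod_(i <- s | P i) (1 - r i).
Proof.
suff [] : 1 - \sum_(i <- s | P i) r i <= \prod_(i <- s | P i) (1 - r i)
  /\ 0 <= \sum_(i <- s | P i) r i by [].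
elim: s => [|i s [IH S0]]; first by rewrite !big_nil subr0 lexx.
rewrite !big_cons; case: ifPn => // /r01 /andP[r0 r1]; split; last by nra.
nra.
Qed.

Lemma sum_pow_le (R : realFieldType) (t : R) (m : nat) :
  0 <= t <= 2^-1 -> \sum_(0 <= i < m) t ^+ (m - i) <= 2 * t.
Proof.
move=> t01; elim: m => [|m IH]; first by rewrite big_nil; lra.
rewrite big_nat_recr //= subSnn expr1.
rewrite (eq_big_nat _ _ (F2 := fun i => t * t ^+ (m - i))); last first.
  by move=> i /andP[_ im]; rewrite subSn ?exprS // ltnW.
by rewrite -mulr_sumr; nra.
Qed.

(** Both sides of the index j contribute at most one geometric series. *)
Lemma sum_pow_dist_le (R : realFieldType) (t : R) (k j : nat) :
  0 <= t <= 2^-1 -> (1 <= j <= k)%N ->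
  \sum_(1 <= i < k.+1 | i != j) t ^+ ((i - j) + (j - i)) <= 4 * t.
Proof.
move=> t01 /andP[j1 jk].
have t0 : 0 <= t by lra.
rewrite (big_cat_nat (n := j)) //=; last lia.
rewrite [X in _ + X]big_ltn_cond ?ltnS // eqxx /=.
have left_le : \sum_(1 <= i < j | i != j) t ^+ ((i - j) + (j - i)) <= 2 * t.
  apply: le_trans (sum_pow_le j t01).
  rewrite [leRHS]big_ltn // -[leLHS]add0r lerD ?exprn_ge0 //.
  rewrite big_mkcond /=; apply: ler_sum_nat => i /andP[_ ij].
  by rewrite ltn_eqF //= (eqP (ltnW ij)).
have right_le :
    \sum_(j.+1 <= i < k.+1 | i != j) t ^+ ((i - j) + (j - i)) <= 2 * t.
  apply: le_trans (sum_pow_le (k - j) t01).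
  rewrite -{1}[j.+1]add0n big_addn subSS.
  rewrite [leRHS]big_nat_rev /= big_mkcond /=.
  apply: ler_sum_nat => i /andP[_ ik].
  have -> : (i + (0 + j.+1) != j)%N by lia.
  by rewrite (_ : (_ + _)%N = (k - j - (0 + (k - j) - i.+1))%N) //; lia.
lra.
Qed.

(** * Ratios of singular values *)

Lemma sqrd_ratio_bounds (R : realType) (c1 c2 rho : R) (n : nat)
    (sigma : nat -> R) (i j : nat) :
  0 < c1 -> 0 < c2 -> 0 < rho -> severely_ill_posed c1 c2 rho n sigma ->
  (1 <= i)%N -> (i <= j)%N -> (j <= n)%N ->
  ((c2 / c1) ^+ 2)^-1 * rho ^+ (2 * (j - i)) <= (sigma i / sigma j) ^+ 2
    <= (c2 / c1) ^+ 2 * rho ^+ (2 * (j - i)).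
Proof.
move=> c1_gt0 c2_gt0 rho_gt0 ill i1 ij jn.
have /andP[si_ge si_le] := ill i ltac:(lia).
have /andP[sj_ge sj_le] := ill j ltac:(lia).
have ri := exprn_gt0 i rho_gt0; have rj := exprn_gt0 j rho_gt0.
have sj_gt0 : 0 < sigma j.
  by apply: lt_le_trans sj_ge; rewrite mulr_gt0 ?invr_gt0.
have si_gt0 : 0 < sigma i.
  by apply: lt_le_trans si_ge; rewrite mulr_gt0 ?invr_gt0.
have -> : rho ^+ (2 * (j - i)) = (rho ^+ j / rho ^+ i) ^+ 2.
  rewrite mulnC exprM; congr (_ ^+ 2).
  by rewrite -{2}(subnK ij) exprD mulfK ?gt_eqF.
rewrite -exprVn invf_div -!exprMn.
have lo_gt0 : 0 < c1 / c2 * (rho ^+ j / rho ^+ i).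
  by rewrite !mulr_gt0 ?invr_gt0.
have hi_gt0 : 0 < c2 / c1 * (rho ^+ j / rho ^+ i).
  by rewrite !mulr_gt0 ?invr_gt0.
have r_gt0 : 0 < sigma i / sigma j by rewrite divr_gt0.
rewrite !ler_sqr ?nnegrE ?(ltW lo_gt0) ?(ltW hi_gt0) ?(ltW r_gt0) //.
rewrite ler_pdivlMr // ler_pdivrMr //; apply/andP; split.
  apply: le_trans si_ge.
  apply: le_trans (ler_wpM2l (ltW lo_gt0) sj_le) _.
  by rewrite le_eqVlt; apply/orP; left; apply/eqP; field; rewrite !gt_eqF.
apply: le_trans si_le _.
apply: le_trans (ler_wpM2l (ltW hi_gt0) sj_ge).
by rewrite le_eqVlt; apply/orP; left; apply/eqP; field; rewrite !gt_eqF.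
Qed.

Lemma prod_even_pow (R : comNzRingType) (a rho : R) (j l : nat) :
  \prod_(j.+1 <= i < (j + l).+1) (a * rho ^+ (2 * (i - j)))
    = a ^+ l * rho ^+ (l * (l + 1)).
Proof.
elim: l => [|l IH]; first by rewrite addn0 big_geq // mul1r.
rewrite addnS big_nat_recr ?ltnS ?leqW ?leq_addr //= IH.
rewrite (_ : ((j + l).+1 - j = l.+1)%N); last lia.
rewrite (_ : (l.+1 * (l.+1 + 1) = l * (l + 1) + 2 * l.+1)%N); last lia.
by rewrite exprSr exprD; ring.
Qed.

Lemma prod_sqrd_ratio_bounds (R : realType) (c1 c2 rho : R) (n : nat)
    (sigma : nat -> R) (j k : nat) :
  0 < c1 -> 0 < c2 -> 0 < rho -> severely_ill_posed c1 c2 rho n sigma ->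
  (1 <= j)%N -> (j <= k)%N -> (k <= n)%N ->
  (((c2 / c1) ^+ 2)^-1) ^+ (k - j) * rho ^+ ((k - j) * (k - j + 1))
    <= \prod_(j.+1 <= i < k.+1) (sigma j / sigma i) ^+ 2
    <= ((c2 / c1) ^+ 2) ^+ (k - j) * rho ^+ ((k - j) * (k - j + 1)).
Proof.
move=> c1_gt0 c2_gt0 rho_gt0 ill j1 jk kn.
rewrite -!(prod_even_pow _ _ j) (subnKC jk) !big_nat.
have bnd i : (j.+1 <= i < k.+1)%N -> _ := fun h =>
  sqrd_ratio_bounds (i := j) (j := i) c1_gt0 c2_gt0 rho_gt0 ill j1
    ltac:(lia) ltac:(lia).
apply/andP; split; apply: ler_prod => i /bnd /andP[lo hi].
  by rewrite lo mulr_ge0 ?invr_ge0 ?sqr_ge0 ?exprn_ge0 ?ltW.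
by rewrite hi sqr_ge0.
Qed.

(** * Separating the dominant product from the correction *)

(** The smaller over the larger of sigma_i ^ 2 and sigma_j ^ 2 for a
    decreasing sigma; extracting the larger one from sigma_j ^ 2 - sigma_i ^ 2
    leaves 1 minus this ratio. *)
Definition small_ratio (R : fieldType) (sigma : nat -> R) (j i : nat) : R :=
  (sigma (maxn i j) / sigma (minn i j)) ^+ 2.

Lemma absL0_factor (R : realFieldType) (sigma : nat -> R) (j i : nat) :
  0 < sigma i -> 0 < sigma j -> i != j ->
  ((i < j)%N -> sigma j < sigma i) -> ((j < i)%N -> sigma i < sigma j) ->
  sigma i ^+ 2 / `|sigma j ^+ 2 - sigma i ^+ 2|
    = (1 - small_ratio sigma j i)^-1
      / (if (j < i)%N then (sigma j / sigma i) ^+ 2 else 1).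
Proof.
move=> si sj; rewrite /small_ratio; case: (ltngtP i j) => // _ _.
  move=> /(_ isT) lt _.
  have d : 0 < sigma i ^+ 2 - sigma j ^+ 2 by nra.
  rewrite ltr0_norm ?opprB; last lra.
  by rewrite divr1 expr_div_n; field; rewrite !gt_eqF.
move=> _ /(_ isT) lt.
have d : 0 < sigma j ^+ 2 - sigma i ^+ 2 by nra.
by rewrite gtr0_norm // expr_div_n; field; rewrite !gt_eqF.
Qed.

(** Comparing two singular values costs one factor K = (c2 / c1) ^ 2 whatever
    the distance d >= 1 of the indices; K <= K ^ d turns the bound
    K / rho ^ (2 d) into a geometric one, which can be summed. *)
Lemma small_ratio_bounds (R : realType) (c1 c2 rho : R) (n : nat)
    (sigma : nat -> R) (j i : nat) :
  0 < c1 -> c1 <= c2 -> 0 < rho -> severely_ill_posed c1 c2 rho n sigma ->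
  (1 <= j <= n)%N -> (1 <= i <= n)%N -> i != j ->
  0 <= small_ratio sigma j i
    <= ((c2 / c1) ^+ 2 / rho ^+ 2) ^+ ((i - j) + (j - i)).
Proof.
move=> c1_gt0 c1c2 rho_gt0 ill j_in i_in ij.
have c2_gt0 : 0 < c2 by apply: lt_le_trans c1c2.
have K_ge1 : 1 <= (c2 / c1) ^+ 2 by rewrite exprn_ege1 // ler_pdivlMr // mul1r.
have K_gt0 := lt_le_trans ltr01 K_ge1.
rewrite /small_ratio sqr_ge0 /=.
have /andP[lo _] := sqrd_ratio_bounds (i := minn i j) (j := maxn i j)
  c1_gt0 c2_gt0 rho_gt0 ill ltac:(lia) ltac:(lia) ltac:(lia).
have e : (maxn i j - minn i j = (i - j) + (j - i))%N by lia.
rewrite e in lo; set d := (_ + _)%N in lo *.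
have rd : 0 < rho ^+ (2 * d) by rewrite exprn_gt0.
have pos : 0 < ((c2 / c1) ^+ 2)^-1 * rho ^+ (2 * d).
  by rewrite mulr_gt0 ?invr_gt0.
rewrite -[sigma _ / sigma _]invf_div exprVn.
apply: (@le_trans _ _ ((c2 / c1) ^+ 2 / rho ^+ (2 * d))).
  rewrite -[leRHS]invrK lef_pV2 ?posrE ?invr_gt0 ?divr_gt0 //.
    by rewrite invf_div mulrC.
  exact: lt_le_trans lo.
rewrite [leRHS]expr_div_n -(exprM rho) ler_pM2r ?invr_gt0 //.
by rewrite ler_eXnr // /d; lia.
Qed.

(** The correction factor: summability of the r i makes the bound independent
    of k and j. *)
Lemma prod_inv_1sub_bounds (R : realFieldType) (t : R) (k j : nat)
    (r : nat -> R) :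
  0 <= t <= 8^-1 -> (1 <= j <= k)%N ->
  (forall i, (1 <= i <= k)%N -> i != j ->
    0 <= r i <= t ^+ ((i - j) + (j - i))) ->
  1 <= \prod_(1 <= i < k.+1 | i != j) (1 - r i)^-1 <= 1 + 8 * t.
Proof.
move=> t_in j_in r_in.
have r01 i : (1 <= i < k.+1)%N && (i != j) -> 0 <= r i <= 1.
  move=> /andP[ik ij]; have /andP[-> /le_trans->//] := r_in i ik ij.
  by rewrite exprn_ile1 //; lra.
have sum_le : \sum_(1 <= i < k.+1 | i != j) r i <= 4 * t.
  apply: le_trans (sum_pow_dist_le (t := t) _ j_in); last by lra.
  rewrite big_nat_cond [leRHS]big_nat_cond; apply: ler_sum => i /andP[ik ij].
  by have /andP[] := r_in i ik ij.
have prod_ge : 1 - 4 * t <= \prod_(1 <= i < k.+1 | i != j) (1 - r i).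
  apply: (@le_trans _ _ (1 - \sum_(1 <= i < k.+1 | i != j) r i)); first by lra.
  rewrite [\sum_(_ <= _ < _ | _) _]big_nat_cond [leRHS]big_nat_cond.
  exact: prod_1sub_ge.
have prod_le : \prod_(1 <= i < k.+1 | i != j) (1 - r i) <= 1.
  rewrite big_nat_cond; apply: prodr_ile1 => i /r01 /andP[r0 r1].
  by apply/andP; split; lra.
have prod_gt0 : 0 < \prod_(1 <= i < k.+1 | i != j) (1 - r i) by lra.
rewrite prodfV invf_ge1 // prod_le /=.
rewrite -[leRHS]mul1r -[leLHS]mul1r ler_pdivrMr // mul1r.
(* (1 + 8 t) (1 - 4 t) >= 1 as soon as t <= 1/8. *)
by nra.
Qed.

(** D takes only the indices above j, where the numerator sigma_i ^ 2 is not
    the dominant square of the denominator. *)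
Lemma absL0_split (R : realType) (sigma : nat -> R) (k j : nat) :
  (1 <= j <= k)%N ->
  (forall i, (1 <= i <= k)%N -> 0 < sigma i) ->
  (forall i l, (1 <= i)%N -> (i < l)%N -> (l <= k)%N -> sigma l < sigma i) ->
  absL0 sigma k j = \prod_(1 <= i < k.+1 | i != j) (1 - small_ratio sigma j i)^-1
    / \prod_(j.+1 <= i < k.+1) (sigma j / sigma i) ^+ 2.
Proof.
move=> j_in pos decr.
have -> : \prod_(j.+1 <= i < k.+1) (sigma j / sigma i) ^+ 2
    = \prod_(1 <= i < k.+1 | i != j)
        (if (j < i)%N then (sigma j / sigma i) ^+ 2 else 1).
  rewrite [RHS](big_cat_nat (n := j.+1)) //=; [|lia..].
  rewrite [X in _ = X * _]big_nat_cond [X in _ = X * _]big1 ?mul1r; last first.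
    by move=> i /andP[/andP[_ ij] _]; rewrite ltnNge -ltnS ij.
  rewrite [RHS]big_mkcond /=; apply: eq_big_nat => i /andP[ji _].
  by rewrite ji gtn_eqF.
rewrite -prodf_div /absL0 big_nat_cond [RHS]big_nat_cond.
apply: eq_bigr => i /andP[ik ij].
apply: absL0_factor => //; [exact: pos|exact: pos| |] => lt; apply: decr; lia.
Qed.

(** * Asymptotics of the Lagrange basis values at 0 *)

Theorem theorem4p3 (R : realType) (c1 c2 : R) (c1_gt0 : 0 < c1)
    (c1_le_c2 : c1 <= c2) :
  (* [d1 l], [d2 l]: multiples in the exact order of the denominator, l = k - j *)
  exists d1 d2 : nat -> R, (forall l, 0 < d1 l /\ 0 < d2 l) /\
  exists rho0 : R, 1 < rho0 /\
  exists C : R,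
  forall (m n : nat) (A : 'M[R]_(m, n)) (sigma : nat -> R) (rho : R),
    (n <= m)%N ->
    singular_values A sigma ->
    (forall i j, (1 <= i)%N -> (i < j)%N -> (j <= n)%N -> sigma j < sigma i) ->
    (forall j, (1 <= j <= n)%N -> 0 < sigma j) ->
    rho0 <= rho ->
    severely_ill_posed c1 c2 rho n sigma ->
  forall k, (2 <= k <= n - 1)%N ->
    [/\ one_plus_O C rho (absL0 sigma k k),
        forall j, (1 <= j <= k - 1)%N ->
          let D := \prod_(j.+1 <= i < k.+1) (sigma j / sigma i) ^+ 2 in
          (exists2 x, one_plus_O C rho x & absL0 sigma k j = x / D) /\
          d1 (k - j)%N * rho ^+ ((k - j) * (k - j + 1)) <= D
            <= d2 (k - j)%N * rho ^+ ((k - j) * (k - j + 1))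
      & forall k1, (1 <= k1 <= k)%N ->
          absL0 sigma k k1 = \big[Num.max/0]_(1 <= j < k.+1) absL0 sigma k j ->
          one_plus_O C rho (absL0 sigma k k1)].
Proof.
have c2_gt0 : 0 < c2 by apply: lt_le_trans c1_le_c2.
set K := (c2 / c1) ^+ 2.
have q_ge1 : 1 <= c2 / c1 by rewrite ler_pdivlMr // mul1r.
have K_gt0 : 0 < K by rewrite exprn_gt0 ?divr_gt0.
exists (fun l => K^-1 ^+ l), (fun l => K ^+ l); split.
  by move=> l; split; apply: exprn_gt0; rewrite ?invr_gt0.
(* 9 K <= rho ^ 2 puts t = K / rho ^ 2 below 1/8. *)
exists (3 * (c2 / c1)); split; first by lra.
exists (8 * K) => m n A sigma rho _ _ decr pos rho_ge ill k k_in.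
have rho_gt0 : 0 < rho by lra.
have rho2_gt0 : 0 < rho ^+ 2 by rewrite exprn_gt0.
have t_in : 0 <= K / rho ^+ 2 <= 8^-1.
  rewrite divr_ge0 ?(ltW K_gt0) ?(ltW rho2_gt0) //= ler_pdivrMr //.
  apply: (@le_trans _ _ (8^-1 * (3 * (c2 / c1)) ^+ 2)).
    by rewrite exprMn -/K; lra.
  by rewrite ler_pM2l ?invr_gt0 // ler_sqr ?nnegrE //; lra.
have kn : (k <= n)%N by clear -k_in; lia.
have k_gt0 : (1 <= k)%N by clear -k_in; lia.
have in_n i : (1 <= i <= k)%N -> (1 <= i <= n)%N.
  by move=> /andP[-> /leq_trans->].
have corr j : (1 <= j <= k)%N ->
    1 <= \prod_(1 <= i < k.+1 | i != j) (1 - small_ratio sigma j i)^-1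
      <= 1 + 8 * (K / rho ^+ 2).
  move=> j_in; apply: prod_inv_1sub_bounds => // i i_in.
  by apply: (small_ratio_bounds c1_gt0 _ _ ill); rewrite ?in_n.
have split_j j : (1 <= j <= k)%N -> _ := fun j_in => absL0_split j_in
  (fun i i_in => pos i (in_n i i_in))
  (fun i l i1 il lk => decr i l i1 il (leq_trans lk kn)).
have one_plusE x : 1 <= x <= 1 + 8 * (K / rho ^+ 2) ->
    one_plus_O (8 * K) rho x.
  by move=> /andP[x1 x2]; rewrite /one_plus_O ger0_norm; lra.
have Lkk : 1 <= absL0 sigma k k <= 1 + 8 * (K / rho ^+ 2).
  have kk : (1 <= k <= k)%N by rewrite k_gt0 /=.
  by rewrite split_j // [X in _ / X]big_geq // divr1 corr.
split; first exact: one_plusE.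
- move=> j j_in D.
  have /andP[j_gt0 jk] : (1 <= j <= k)%N by clear -j_in; lia.
  have j_in_k : (1 <= j <= k)%N by rewrite j_gt0.
  split.
    exists (\prod_(1 <= i < k.+1 | i != j) (1 - small_ratio sigma j i)^-1).
      exact/one_plusE/corr.
    exact: split_j.
  exact: (prod_sqrd_ratio_bounds c1_gt0 c2_gt0 rho_gt0 ill).
- move=> k1 k1_in k1_max; apply: one_plusE; apply/andP; split.
    have /andP[/le_trans-> //] := Lkk.
    by rewrite k1_max; apply: le_bigmax_seq; rewrite // mem_index_iota ltnS k_gt0 /=.
  have /andP[x_ge1 x_le] := corr k1 k1_in.
  rewrite split_j //; apply: le_trans x_le.
  (* sigma decreases, so D >= 1. *)
  have D_ge1 : 1 <= \prod_(k1.+1 <= i < k.+1) (sigma k1 / sigma i) ^+ 2.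
    rewrite big_nat; apply: (big_ind (fun x : R => 1 <= x)) => [//|x y|i /andP[k1i ik]].
      exact: mulr_ege1.
    have k1_gt0 : (1 <= k1)%N by have /andP[] := k1_in.
    have i_in : (1 <= i <= n)%N by rewrite (leq_trans _ k1i) //= (leq_trans _ kn).
    rewrite exprn_ege1 // ler_pdivlMr ?pos // mul1r ltW // decr //.
    by have /andP[] := i_in.
  have D_gt0 := lt_le_trans ltr01 D_ge1.
  by rewrite ler_piMr ?(le_trans ler01) // invf_le1.
Qed.
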